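(* Let $q\in(0,1)$, let $\sigma=(\sigma_1,\sigma_2,\ldots)\in\{+1,-1\}^\infty$ contain infinitely many $+1$'s and infinitely many $-1$'s, and let $b(n)=\#\{1\le i\le n:\sigma_i=-1\}$. Let $\mathbf t\in\mathfrak X$ and let $\{\mu(N)\in\mathbb{GT}_N\}_{N\ge1}$ be a sequence of random signatures such that each $\mu(N)$ is $M^{\mathbf t}_N$-distributed. Then, for each $k\in\mathbb Z$, the probability of the event $$\mu(L)_{b(L)+k}=t_{1-k}$$ tends to $1$ as $L\to\infty$.
   Context: $\mathbb{GT}_N$ is the set of signatures $\lambda=(\lambda_1\ge\cdots\ge\lambda_N)\in\mathbb Z^N$; $s_\lambda(x_1,\ldots,x_N)=\det[x_i^{\lambda_j+N-j}]_{i,j=1}^N/\prod_{i<j}(x_i-x_j)$ is the Schur Laurent polynomial. $\mathfrak X$ is the set of doubly infinite nondecreasing integer sequences $\mathbf t=(\cdots\le t_{-1}\le t_0\le t_1\le\cdots)$. Markov kernels. For $N\ge1$, $\lambda\in\mathbb{GT}_{N+1}$, the numbers $\Lambda^{N+1}_N(\lambda,\mu)$, $\mu\in\mathbb{GT}_N$, are the unique coefficients in $$\frac{s_\lambda(x_1,\ldots,x_N,q^{-N})}{s_\lambda(1,q^{-1},\ldots,q^{-N})}=\sum_{\mu\in\mathbb{GT}_N}\Lambda^{N+1}_N(\lambda,\mu)\frac{s_\mu(x_1,\ldots,x_N)}{s_\mu(1,q^{-1},\ldots,q^{1-N})}\quad\text{if }\sigma_{N+1}=-1,$$ $$\frac{s_\lambda(x_1,\ldots,x_N,q^{N})}{s_\lambda(1,q,\ldots,q^{N})}=\sum_{\mu\in\mathbb{GT}_N}\Lambda^{N+1}_N(\lambda,\mu)\frac{s_\mu(x_1,\ldots,x_N)}{s_\mu(1,q,\ldots,q^{N-1})}\quad\text{if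 }\sigma_{N+1}=+1.$$ These matrices are stochastic. For $N>k$ let $\Lambda^N_k=\Lambda^N_{N-1}\Lambda^{N-1}_{N-2}\cdots\Lambda^{k+1}_k$. A sequence $\{\lambda(N)\in\mathbb{GT}_N\}$ $\mathbf b$-stabilizes to $\mathbf t$ if $\lim_{N\to\infty}\lambda(N)_{b(N)+1-i}=t_i$ for all $i\in\mathbb Z$. For $\mathbf t\in\mathfrak X$ and $k\ge1$, $M^{\mathbf t}_k$ is the probability measure on $\mathbb{GT}_k$ given by $M^{\mathbf t}_k(\mu)=\lim_{N\to\infty}\Lambda^N_k(\lambda(N),\mu)$ for any sequence $\{\lambda(N)\}$ that $\mathbf b$-stabilizes to $\mathbf t$ (the limit exists, defines a probability measure, and is independent of the sequence). *)

(* Defs.v *)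
From HB Require Import structures.
From mathcomp Require Import all_boot all_order all_algebra.
From mathcomp Require Import all_classical all_reals all_analysis.

Set Implicit Arguments.
Unset Strict Implicit.
Unset Printing Implicit Defensive.

Import Order.TTheory GRing.Theory Num.Theory.
Import numFieldNormedType.Exports.

Local Open Scope classical_set_scope.
Local Open Scope ring_scope.

(* Signatures of length N.  The part lam_i, 1 <= i <= N, is the entry of
   0-based index i - 1 of the tuple. *)
Record GT (N : nat) := Signature {
  sig_tuple :> N.-tuple int;
  sig_noninc : sorted >=%R sig_tuple }.

HB.instance Definition _ (N : nat) := [isSub for @sig_tuple N].
HB.instance Definition _ (N : nat) := [Countable of GT N by <:].

Lemma sorted_nseq0 (N : nat) : sorted >=%R (nseq_tuple N (0 : int)).
Proof.
by case: N => //= N; elim: N => //= N ->; rewrite lexx.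
Qed.

HB.instance Definition _ (N : nat) :=
  isPointed.Build (GT N) (Signature (sorted_nseq0 N)).

(* GT N is countable and carries the discrete sigma-algebra. *)
HB.instance Definition _ (N : nat) :=
  @isMeasurable.Build default_measure_display (GT N) discrete_measurable
    discrete_measurable0 discrete_measurableC discrete_measurableU.

(* lam_i with the 1-based index i : int; the junk value 0 is used when i is not
   in {1, ..., N}. *)
Definition part (N : nat) (lam : GT N) (i : int) : int :=
  if 0 < i then nth 0 lam `|i - 1|%N else 0.

(* The bialternant formula.  It is meant to be used only at points with nonzero
   pairwise distinct coordinates, where it is the value of the Schur Laurent
   polynomial.  With j : 'I_n counted from 0, N - j reads n - j.+1. *)
Definition schur (F : fieldType) (n : nat) (lam : GT n) (x : 'I_n -> F) : F :=
  \det (\matrix_(i < n, j < n) x i ^ (tnth lam j + (n - j.+1)%N%:Z)) /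
  \prod_(i < n) \prod_(j < n | (i < j)%N) (x i - x j).

(* (x_1, ..., x_N, y) *)
Definition extend (F : Type) (N : nat) (x : 'I_N -> F) (y : F) : 'I_N.+1 -> F :=
  fun i => if unlift ord_max i is Some j then x j else y.

(* (1, p, ..., p^(n-1)) *)
Definition geom (F : fieldType) (n : nat) (p : F) : 'I_n -> F :=
  fun i => p ^+ i.

(* c is the row of coefficients of the normalized Schur Laurent polynomial
   s_lam(x_1, ..., x_N, p^N) / s_lam(1, p, ..., p^N) in the basis of normalized
   Schur Laurent polynomials in x_1, ..., x_N; p is q^-1 or q.  The expansion
   is a finite linear combination, and the identity of Laurent polynomials is
   stated at all x where the bialternant formulas make sense. *)
Definition is_link_row (R : realType) (p : R) (N : nat) (lam : GT N.+1)
    (c : GT N -> R) : Prop :=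
  finite_set [set mu | c mu != 0] /\
  forall x : 'I_N -> R,
    (forall i, x i != 0) -> injective (extend x (p ^+ N)) ->
    schur lam (extend x (p ^+ N)) / schur lam (geom p) =
    \sum_(mu \in [set: GT N]) c mu * (schur mu x / schur mu (geom p)).

(* Lambda^{N+1}_N; as sigma_{N+1} is 1 or -1, q ^ sigma_{N+1} is q or q^-1. *)
Definition link (R : realType) (q : R) (sigma : nat -> int) (N : nat)
    (lam : GT N.+1) : GT N -> R :=
  xget (fun=> 0) [set c | is_link_row (q ^ sigma N.+1) lam c].

(* Lambda^N_k for N > k is the product Lambda^N_{N-1} ... Lambda^{k+1}_k; the
   recursion is started at Lambda^k_k, the identity matrix, whose entries are
   written by comparing underlying sequences because N and k are not
   syntactically equal there (and the value for N < k is 0). *)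
Fixpoint kernel_prod (R : realType) (q : R) (sigma : nat -> int) (N k : nat) :
    GT N -> GT k -> R :=
  match N return GT N -> GT k -> R with
  | 0 => fun lam mu => ((lam : seq int) == (mu : seq int))%:R
  | N'.+1 => fun lam mu =>
      if (k <= N')%N then
        \sum_(nu \in [set: GT N'])
          link q sigma lam nu * kernel_prod q sigma nu mu
      else ((lam : seq int) == (mu : seq int))%:R
  end.

(* b(n) = #{1 <= i <= n : sigma_i = -1} *)
Definition bfun (sigma : nat -> int) (n : nat) : nat :=
  count (fun i => sigma i == -1) (iota 1 n).

Definition b_stabilizes (sigma : nat -> int) (lam : forall N, GT N)
    (t : int -> int) : Prop :=
  forall i : int,
    (fun N => part (lam N) ((bfun sigma N)%:Z + 1 - i) : discrete_topology int)
      @ \oo --> (t i : discrete_topology int).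

(* M^t_k(mu): the common limit along all sequences that b-stabilize to t. *)
Definition Mt (R : realType) (q : R) (sigma : nat -> int) (t : int -> int)
    (k : nat) (mu : GT k) : R :=
  xget 0 [set p : R | forall lam : forall N, GT N, b_stabilizes sigma lam t ->
    (fun N => kernel_prod q sigma (lam N) mu) @ \oo --> p].

(* Main.v *)
Require Import Defs.
From mathcomp Require Import all_boot all_order all_algebra.
From mathcomp Require Import all_classical all_reals all_analysis.
From mathcomp Require Import fingroup perm.
From mathcomp Require Import ring lra zify.

Set Implicit Arguments.
Unset Strict Implicit.
Unset Printing Implicit Defensive.

Import Order.TTheory GRing.Theory Num.Theory.
Import numFieldNormedType.Exports.

Local Open Scope classical_set_scope.
Local Open Scope ring_scope.

(** The part of index [b(N) + k] is transported unchanged by the links, except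
    with a probability that decays geometrically along the chain.

    Fix [L].  The measure [M^t_L] is a limit of the rows of [Lambda^N_L] at the
    signatures [lambda(N)] cut out of [t], and [lambda(N)] has the part
    [t_(1-k)] in position [b(N) + k].  So it suffices to follow the Markov chain
    from level [N] down to level [L] and to bound, uniformly in [N], the
    probability that the part in position [b + k] changes on the way.

    The links are explicit.  The branching rule [schur_branching] expands
    [s_lambda(x, y)] over the signatures interlacing with [lambda], and Schur
    functions are linearly independent as functions of [x]
    ([schur_independent]), so that with [p = q] or [p = 1/q] the link is
    [p^(N (|lambda| - |mu|)) s_mu(1, ..., p^(N-1)) / s_lambda(1, ..., p^N)] on
    interlacing [mu] ([linkE]).  By the Vandermonde determinant,
    [s_mu(1, ..., p^(N-1))] is, up to a constant, the product over [i < j] of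
    [|p^(m_i) - p^(m_j)|] with [m_i = mu_i + N - i].  Collecting powers of [q],
    the link gives [mu] the weight
    - [prod_i q^(i mu_i)] if [sigma_(N+1) = -1],
    - [prod_i q^(- (N+1-i) mu_i)] if [sigma_(N+1) = +1],
    times the bounded interaction [prod_(i<j) (1 - q^(m_i - m_j))].  Hence in
    the first case [mu_i] sticks to the bottom [lambda_(i+1)] of its interval,
    and in the second to the top [lambda_i].  The position [i = b(N) + k] is
    tuned so that both are the part of index [b(N+1) + k] of [lambda].
    Resetting [mu_i] to that end of the interval changes the interaction by a
    factor that is bounded by the inverse of the infinite product
    [prod_n (1 - q^n)], whatever the other parts are; so the part is missed with
    probability at most [C q^i], respectively [C q^(N+1-i)] ([step_minus],
    [step_plus]).

    As [sigma] takes both values infinitely often, these errors form two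
    geometric series, one in [b(N)] and one in [N - b(N)].  The function
    [escape] is the sum of their tails, and its value at [L] bounds the
    probability of a change between the levels [N] and [L], for every [N]
    ([kernel_escape]).  The bound passes to the limit [N --> oo]
    ([Mt_escape]), and it tends to [0] as [L] grows. *)

(** * Signatures and interlacing *)

(** The strictly decreasing exponents of the bialternant formula. *)
Definition shifted n (lam : GT n) (j : 'I_n) : int :=
  tnth lam j + (n - j.+1)%N%:Z.

Definition weight n (lam : GT n) : int := \sum_(j < n) tnth lam j.

Lemma tnth_noninc n (lam : GT n) (i j : 'I_n) :
  (i <= j)%N -> tnth lam j <= tnth lam i.
Proof.
move=> ij; rewrite !(tnth_nth 0).
by apply: (sorted_leq_nth ge_trans ge_refl 0 (sig_noninc lam));
  rewrite ?inE ?size_tuple.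
Qed.

Lemma shifted_gap n (lam : GT n) (i j : 'I_n) :
  (i <= j)%N -> (j - i)%N%:Z <= shifted lam i - shifted lam j.
Proof.
move=> ij; have := tnth_noninc lam ij; rewrite /shifted.
have := ltn_ord j; lia.
Qed.

Lemma shifted_lt n (lam : GT n) (i j : 'I_n) :
  (i < j)%N -> shifted lam j < shifted lam i.
Proof. by move=> ij; have := shifted_gap lam (ltnW ij); lia. Qed.

Lemma shifted_inj n (lam : GT n) : injective (shifted lam).
Proof.
move=> i j e; apply: val_inj => /=.
by case: (ltngtP i j) => // /(shifted_lt lam); rewrite e ltxx.
Qed.

Lemma eq_GT n (lam mu : GT n) : tnth lam =1 tnth mu -> lam = mu.
Proof. by move=> e; apply: val_inj; apply: eq_from_tnth. Qed.

Lemma sorted_ord_tuple n (r : rel int) (f : 'I_n -> int) :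
  (forall i j : 'I_n, (i < j)%N -> r (f i) (f j)) -> sorted r [tuple f j | j < n].
Proof.
move=> fr; apply/(sortedP 0) => i; rewrite size_tuple => lti.
have -> : [tuple f j | j < n]`_i = f (Ordinal (ltnW lti)).
  by rewrite -[i]/(nat_of_ord (Ordinal (ltnW lti))) -tnth_nth tnth_mktuple.
have -> : [tuple f j | j < n]`_i.+1 = f (Ordinal lti).
  by rewrite -[i.+1]/(nat_of_ord (Ordinal lti)) -tnth_nth tnth_mktuple.
exact: fr.
Qed.

(** A total constructor: signatures are built from functions on indices without
    carrying a monotonicity proof, at the price of a junk value when the
    function is not nonincreasing. *)
Definition mkGT n (f : 'I_n -> int) : GT n :=
  insubd (point : GT n) [tuple f j | j < n].

Lemma tnth_mkGT n (f : 'I_n -> int) (j : 'I_n) :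
  (forall i j : 'I_n, (i < j)%N -> f j <= f i) -> tnth (mkGT f) j = f j.
Proof.
move=> /(@sorted_ord_tuple n >=%R) srt; rewrite /mkGT.
have -> : tnth (insubd (point : GT n) [tuple f j | j < n]) j =
          tnth (val (insubd (point : GT n) [tuple f j | j < n])) j by [].
by rewrite val_insubd srt tnth_mktuple.
Qed.

Section Interlacing.
Variables (N : nat) (lam : GT N.+1).

Definition interlaces (f : 'I_N -> int) : bool :=
  [forall j, tnth lam (lift ord0 j) <= f j <= tnth lam (lift ord_max j)].

Lemma tnth_mkGT_interlaces (f : 'I_N -> int) :
  interlaces f -> forall j, tnth (mkGT f) j = f j.
Proof.
move=> /forallP fI j; apply: tnth_mkGT => i i' ii'.
have /andP[le1 _] := fI i; have /andP[_ le2] := fI i'.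
apply: le_trans le2 (le_trans _ le1); apply: tnth_noninc.
by rewrite lift_max lift0.
Qed.

(** The signatures interlacing with [lam] form a box: the parts range over
    intervals independently of each other.  They are enumerated by the
    heights above the lower corner, all taken in one ordinal type so that the
    box is a family of finite functions. *)
Definition gap (j : 'I_N) : nat :=
  `|tnth lam (lift ord_max j) - tnth lam (lift ord0 j)|%N.

Definition gap_bound : nat := (\max_j gap j).+1.

Definition increments : pred {ffun 'I_N -> 'I_gap_bound} :=
  family (fun j => [pred x : 'I_gap_bound | (x <= gap j)%N]).

Definition of_increments (a : {ffun 'I_N -> 'I_gap_bound}) : GT N :=
  mkGT (fun j => tnth lam (lift ord0 j) + (a j : nat)%:Z).

Definition below : seq (GT N) := [seq of_increments a | a in increments].

Lemma gapE j :
  (gap j)%:Z = tnth lam (lift ord_max j) - tnth lam (lift ord0 j).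
Proof.
have : tnth lam (lift ord0 j) <= tnth lam (lift ord_max j).
  by apply: tnth_noninc; rewrite lift0 lift_max.
by rewrite /gap; lia.
Qed.

Lemma tnth_of_increments a j : a \in increments ->
  tnth (of_increments a) j = tnth lam (lift ord0 j) + (a j : nat)%:Z.
Proof.
move=> /familyP aI; apply: tnth_mkGT_interlaces; apply/forallP => i.
by have := aI i; rewrite inE => ai; rewrite lerDl /= -lerBrDl -gapE lez_nat.
Qed.

Lemma mem_below mu : (mu \in below) = interlaces (tnth mu).
Proof.
apply/fintype.imageP/idP => [[a aI ->]|/forallP muI].
  apply/forallP => i; rewrite tnth_of_increments //.
  by have /familyP/(_ i) := aI; rewrite inE => ai; rewrite lerDl /= -lerBrDl -gapE lez_nat.
pose d j := `|tnth mu j - tnth lam (lift ord0 j)|%N.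
have dE j : (d j)%:Z = tnth mu j - tnth lam (lift ord0 j).
  by have := muI j; rewrite /d; lia.
have dgap j : (d j <= gap j)%N by have := muI j; have := dE j; have := gapE j; lia.
have db j : (d j < gap_bound)%N by rewrite ltnS (leq_trans (dgap j)) ?leq_bigmax.
have aI : [ffun j => Ordinal (db j)] \in increments.
  by apply/familyP => j; rewrite ffunE inE; apply: dgap.
exists [ffun j => Ordinal (db j)] => //.
by apply: eq_GT => j; rewrite tnth_of_increments // ffunE /= dE; lia.
Qed.

Lemma uniq_below : uniq below.
Proof.
rewrite map_inj_in_uniq ?enum_uniq // => a b; rewrite !mem_enum => aI bI e.
apply/ffunP => j; apply: val_inj; have := congr1 (fun m : GT N => tnth m j) e.
by rewrite !tnth_of_increments // => /addrI [].
Qed.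

End Interlacing.

(** * Branching rule and principal specialization *)

Lemma big_ord_lift_max (R : Type) (idx : R) (op : Monoid.com_law idx) n
    (F : 'I_n.+1 -> R) :
  \big[op/idx]_(i < n.+1) F i = op (\big[op/idx]_(i < n) F (lift ord_max i)) (F ord_max).
Proof.
rewrite big_ord_recr /=; congr (op _ _); apply: eq_bigr => i _; congr F.
by apply: val_inj => /=; rewrite /bump leqNgt ltn_ord.
Qed.

Lemma extend_lift (F : Type) N (x : 'I_N -> F) y i : extend x y (lift ord_max i) = x i.
Proof. by rewrite /extend liftK. Qed.

Lemma extend_max (F : Type) N (x : 'I_N -> F) y : extend x y ord_max = y.
Proof. by rewrite /extend unlift_none. Qed.

Lemma det_scale_cols (R : comNzRingType) n (c : 'I_n -> R) (A : 'I_n -> 'I_n -> R) :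
  \det (\matrix_(i, j) (c j * A i j)) = \prod_j c j * \det (\matrix_(i, j) A i j).
Proof.
have -> : \matrix_(i, j) (c j * A i j) = (\matrix_(i, j) A i j) *m diag_mx (\row_j c j).
  by rewrite mul_mx_diag; apply/matrixP => i j; rewrite !mxE mulrC.
rewrite det_mulmx det_diag mulrC; congr (_ * _).
by apply: eq_bigr => j _; rewrite mxE.
Qed.

Lemma det_scale_rows (R : comNzRingType) n (c : 'I_n -> R) (A : 'I_n -> 'I_n -> R) :
  \det (\matrix_(i, j) (c i * A i j)) = \prod_i c i * \det (\matrix_(i, j) A i j).
Proof.
have tr B : \det (\matrix_(i, j) B i j : 'M[R]_n) = \det (\matrix_(i, j) B j i).
  by rewrite -det_tr; congr (\det _); apply/matrixP => i j; rewrite !mxE.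
rewrite (tr (fun i j => c i * A i j)) (tr A); exact: (det_scale_cols c (fun i j => A j i)).
Qed.

Lemma det_sum_cols (R : comNzRingType) n (J : finType) (Q : 'I_n -> pred J)
    (A : 'I_n -> 'I_n -> J -> R) :
  \det (\matrix_(i, j) \sum_(x | Q j x) A i j x) =
  \sum_(a in family Q) \det (\matrix_(i, j) A i j (a j)).
Proof.
rewrite -det_tr /determinant.
under [RHS]eq_bigr => a _ do rewrite -/(determinant _) -det_tr /determinant.
rewrite exchange_big /=; apply: eq_bigr => s _; rewrite -mulr_sumr; congr (_ * _).
under eq_bigr => i _ do rewrite !mxE.
rewrite bigA_distr_big_dep /=; apply: eq_bigr => a _.
by apply: eq_bigr => i _; rewrite !mxE.
Qed.

(** Subtracting from every column the next one clears the last row except for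
    its last entry. *)
Lemma det_last_row_ones (R : comNzRingType) n (B : 'M[R]_n.+1) :
  (forall j, B ord_max j = 1) ->
  \det B = \det (\matrix_(i < n, j < n)
    (B (lift ord_max i) (lift ord_max j) - B (lift ord_max i) (lift ord0 j))).
Proof.
move=> B1; pose U : 'M[R]_n.+1 :=
  (* Right multiplication by this triangular matrix is the column operation. *)
  \matrix_(k, j) ((k == j)%:R - (k == j.+1 :> nat)%:R).
have BU i j : (B *m U) i j =
    B i j - (if unlift ord_max j is Some j' then B i (lift ord0 j') else 0).
  rewrite mxE; under eq_bigr => k _ do rewrite mxE mulrBr.
  rewrite sumrB; congr (_ - _).
    rewrite (bigD1 j) //= eqxx mulr1 big1 ?addr0 // => k /negPf->; exact: mulr0.
  case: unliftP => [j' ->|->].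
    rewrite lift_max (bigD1 (lift ord0 j')) // lift0 eqxx mulr1.
    rewrite big1 => [|k kj]; first exact: addr0.
    case: eqP => [e|]; last by rewrite mulr0.
    by case/eqP: kj; apply: ord_inj; rewrite lift0.
  apply: big1 => k _; case: eqP => [e|]; last by rewrite mulr0.
  by have := ltn_ord k; rewrite e ltnn.
have dU : \det U = 1.
  rewrite det_trig; last first.
    apply/is_trig_mxP => i j ij; rewrite mxE.
    have /negPf-> : i != j by apply: contraTneq ij => ->; rewrite ltnn.
    by rewrite (ltn_eqF (leqW ij : (i < j.+1)%N)) subrr.
  by apply: big1 => i _; rewrite mxE eqxx (ltn_eqF (ltnSn i)) subr0.
have -> : \det B = \det (B *m U) by rewrite det_mulmx dU mulr1.
rewrite (expand_det_row _ ord_max) big_ord_lift_max /= BU unlift_none B1 subr0 mul1r.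
rewrite big1 ?add0r => [|j _]; last by rewrite BU liftK !B1 subrr mul0r.
rewrite /cofactor -signr_odd oddD addbb expr0 mul1r; congr (\det _).
by apply/matrixP => i j; rewrite [LHS]mxE [LHS]mxE BU liftK [RHS]mxE.
Qed.

(** In terms of [z_i = x_i / y] the last row of the numerator consists of ones.
    After the column subtraction, the entries [z_i^(l_j) - z_i^(l_(j+1))] are
    [z_i - 1] times geometric sums over the exponents from [l_(j+1)] to
    [l_j - 1].  Expanding the determinant in these sums, column by column, picks
    in each interval one exponent, which is the shifted part of an interlacing
    signature; the factors [z_i - 1] cancel against the new factors of the
    Vandermonde product. *)
Lemma schur_branching (F : fieldType) N (lam : GT N.+1) (x : 'I_N -> F) (y : F) :
  y != 0 -> (forall i, x i != 0) -> (forall i, x i != y) ->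
  schur lam (extend x y) =
  \sum_(mu <- below lam) y ^ (weight lam - weight mu) * schur mu x.
Proof.
move=> y0 x0 xy; pose l := shifted lam; pose z i := x i / y.
have z0 i : z i != 0 by rewrite mulf_neq0 ?invr_eq0.
have Ey i : extend x y i = y * extend z 1 i.
  rewrite /extend; case: unliftP => [j _|_]; last by rewrite mulr1.
  by rewrite mulrCA divff ?mulr1.
have detN (m : 'I_N -> int) : \det (\matrix_(i, j) z i ^ m j) =
    y ^ (- \sum_j m j) * \det (\matrix_(i, j) x i ^ m j).
  have -> : \matrix_(i, j) z i ^ m j = \matrix_(i, j) (y ^ (- m j) * x i ^ m j).
    by apply/matrixP => i j; rewrite !mxE expfzMl exprz_inv mulrC.
  rewrite (det_scale_cols (fun j => y ^ (- m j)) (fun i j => x i ^ m j)); congr (_ * _).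
  rewrite -sumrN; elim/big_rec2: _ => [|j a b _ ->]; first by rewrite expr0z.
  by rewrite expfzDr.
have num : \det (\matrix_(i, j) extend x y i ^ l j) =
    y ^ (\sum_j l j - N%:Z) * \prod_i (x i - y) *
    \sum_(mu <- below lam) \det (\matrix_(i, j) z i ^ shifted mu j).
  have -> : \matrix_(i, j) extend x y i ^ l j =
            \matrix_(i, j) (y ^ l j * extend z 1 i ^ l j).
    by apply/matrixP => i j; rewrite !mxE Ey expfzMl.
  rewrite (det_scale_cols (fun j => y ^ l j) (fun i j => extend z 1 i ^ l j)).
  rewrite det_last_row_ones; last by move=> j; rewrite !mxE extend_max exp1rz.
  have -> : \matrix_(i < N, j < N)
     ((\matrix_(i, j) extend z 1 i ^ l j) (lift ord_max i) (lift ord_max j) -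
      (\matrix_(i, j) extend z 1 i ^ l j) (lift ord_max i) (lift ord0 j)) =
     \matrix_(i < N, j < N) ((z i - 1) *
       \sum_(a : 'I_(gap_bound lam) | (a <= gap lam j)%N)
         z i ^ (l (lift ord0 j) + (a : nat)%:Z)).
    apply/matrixP => i j; rewrite !mxE !extend_lift.
    have -> : l (lift ord_max j) = l (lift ord0 j) + (gap lam j).+1%:Z.
      rewrite /l /shifted lift0 lift_max; have := gapE lam j.
      by have := ltn_ord j; lia.
    under eq_bigr => a _ do rewrite expfzDr //.
    rewrite -mulr_sumr expfzDr // -{2}[z i ^ l _]mulr1 -mulrBr mulrCA; congr (_ * _).
    rewrite -exprnP subrX1; congr (_ * _).
    by rewrite (big_ord_widen _ (fun a : nat => z i ^+ a)
        (leq_bigmax (F := gap lam) j : ((gap lam j).+1 <= gap_bound lam)%N)).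
  rewrite (det_scale_rows (fun i => z i - 1) (fun i j =>
       \sum_(a : 'I_(gap_bound lam) | (a <= gap lam j)%N)
         z i ^ (l (lift ord0 j) + (a : nat)%:Z))).
  rewrite (det_sum_cols (fun j => [pred a : 'I_(gap_bound lam) | (a <= gap lam j)%N])
         (fun i j (a : 'I__) => z i ^ (l (lift ord0 j) + (a : nat)%:Z))).
  rewrite mulrA; congr (_ * _).
    have -> : \prod_(i < N) (x i - y) = \prod_(i < N) y * \prod_i (z i - 1).
      rewrite -big_split; apply: eq_bigr => i _ /=.
      by rewrite mulrBr mulr1 mulrCA divff ?mulr1.
    rewrite prodr_const card_ord mulrA; congr (_ * _).
    rewrite exprnP -expfzDr // subrK.
    elim/big_rec2: _ => [|j a b _ ->]; first by rewrite expr0z.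
    by rewrite expfzDr.
  rewrite [RHS]big_image /=; apply: eq_bigr => a aI; congr (\det _).
  apply/matrixP => i j; rewrite !mxE; congr (_ ^ _).
  by rewrite /shifted tnth_of_increments // /l /shifted lift0; lia.
have den : \prod_(i < N.+1) \prod_(j < N.+1 | (i < j)%N) (extend x y i - extend x y j) =
    (\prod_(i < N) \prod_(j < N | (i < j)%N) (x i - x j)) * \prod_i (x i - y).
  have prodS (G : 'I_N.+1 -> F) : \prod_i G i = \prod_i G (lift ord_max i) * G ord_max.
    exact: big_ord_lift_max.
  rewrite prodS [X in _ * X]big1 ?mulr1; last first.
    by move=> j; rewrite ltnNge -ltnS ltn_ord.
  rewrite -big_split; apply: eq_bigr => i _.
  have im : (lift ord_max i < @ord_max N)%N by rewrite lift_max ltn_ord.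
  rewrite big_mkcond prodS im extend_lift extend_max; congr (_ * _).
  rewrite [RHS]big_mkcond; apply: eq_bigr => j _.
  by rewrite !lift_max extend_lift.
have Pxy : \prod_i (x i - y) != 0 by apply/prodf_neq0 => i _; rewrite subr_eq0.
rewrite {1}/schur den num invfM.
set V := \prod_(i < N) _; set a := y ^ _; set p := \prod_i _.
set S := \sum_(_ <- below _) _.
have -> : a * p * S * (V^-1 * p^-1) = a * (S / V).
  by rewrite [V^-1 * _]mulrC mulrA [a * p * S]mulrAC mulfK // -mulrA.
rewrite /S mulr_suml mulr_sumr; apply: eq_bigr => mu _.
rewrite detN /schur -/V !mulrA -expfzDr //; congr (y ^ _ * _ / _).
have sumS : \sum_(i < N.+1) (N.+1 - i.+1)%N%:Z = N%:Z + \sum_(i < N) (N - i.+1)%N%:Z.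
  rewrite big_ord_recl subSS subn0; congr (_ + _).
by rewrite /l /weight /shifted !big_split sumS /=; ring.
Qed.

(** At a geometric progression the numerator is the transpose of a Vandermonde
    matrix, in the variables [p^(m_j)]. *)
Lemma schur_geom (F : fieldType) n (mu : GT n) (p : F) :
  schur mu (geom p) =
  \prod_(i < n) \prod_(j < n | (i < j)%N)
    ((p ^ shifted mu j - p ^ shifted mu i) / (p ^+ i - p ^+ j)).
Proof.
rewrite /schur; have -> : \matrix_(i, j) geom p i ^ (tnth mu j + (n - j.+1)%N%:Z) =
    Vandermonde n (\row_j p ^ shifted mu j).
  by apply/matrixP => i j; rewrite !mxE /geom !exprnP !exprz_exp [in RHS]mulrC.
rewrite det_Vandermonde -prodf_div; apply: eq_bigr => i _.
by rewrite -prodf_div; apply: eq_bigr => j _; rewrite !mxE.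
Qed.

Lemma ltr_exprz_lt1 (R : realFieldType) (p : R) (a b : int) :
  0 < p -> p < 1 -> (p ^ a < p ^ b) = (b < a).
Proof.
move=> p0 p1; have e c : p ^ c = p^-1 ^ (- c) by rewrite exprz_inv opprK.
by rewrite !e ltr_eXz2l ?ltrN2 // invf_cp1.
Qed.

Lemma geom_factor_gt0 (R : realFieldType) n (mu : GT n) (p : R) (i j : 'I_n) :
  0 < p -> p != 1 -> (i < j)%N ->
  0 < (p ^ shifted mu j - p ^ shifted mu i) / (p ^+ i - p ^+ j).
Proof.
move=> p0 p1 ij; have := shifted_lt mu ij; move: (shifted mu i) (shifted mu j) => a b ba.
case: (ltgtP p 1) p1 => // p1 _.
  by rewrite divr_gt0 // subr_gt0 ?ltr_exprz_lt1 // ltr_iXn2l.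
rewrite -[X in 0 < X]mulrNN -invrN divr_gt0 // opprB subr_gt0 ?ltr_eXn2l //.
by rewrite ltr_eXz2l.
Qed.

Lemma schur_geom_gt0 (R : realFieldType) n (mu : GT n) (p : R) :
  0 < p -> p != 1 -> 0 < schur mu (geom p).
Proof.
move=> p0 p1; rewrite schur_geom; apply: prodr_gt0 => i _; apply: prodr_gt0 => j ij.
exact: geom_factor_gt0.
Qed.

(** * Uniqueness of the link coefficients *)

Lemma digits_inj B n (f g : 'I_n -> nat) :
  (forall i, (f i < B)%N) -> (forall i, (g i < B)%N) ->
  (\sum_(i < n) B ^ i * f i = \sum_(i < n) B ^ i * g i)%N -> f =1 g.
Proof.
elim: n f g => [|n IHn] f g fB gB; first by move=> _ [].
have shift (h : 'I_n.+1 -> nat) : (\sum_(i < n.+1) B ^ i * h i =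
    (\sum_(i < n) B ^ i * h (lift ord0 i)) * B + h ord0)%N.
  rewrite big_ord_recl mul1n addnC big_distrl; congr (_ + _)%N.
  by apply: eq_bigr => i _; rewrite lift0 expnSr mulnAC.
have B0 : (0 < B)%N by apply: leq_ltn_trans (fB ord0).
rewrite !shift => e.
have e0 : f ord0 = g ord0.
  by have := congr1 (modn^~ B) e; rewrite /= !modnMDl !modn_small.
have /IHn eS : (\sum_(i < n) B ^ i * f (lift ord0 i) =
           \sum_(i < n) B ^ i * g (lift ord0 i))%N.
  by have := congr1 (divn^~ B) e; rewrite /= !divnMDl // !divn_small // !addn0.
move=> i; case: (unliftP ord0 i) => [j ->|-> //].
exact: (eS (fun i => fB _) (fun i => gB _)).
Qed.

(** A decreasing function on an interval is determined by its image. *)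
Lemma decreasing_perm n (f g : 'I_n -> int) (w : 'S_n) :
  (forall i j : 'I_n, (i < j)%N -> f j < f i) -> (forall i j : 'I_n, (i < j)%N -> g j < g i) ->
  (forall i, f (w i) = g i) -> f =1 g.
Proof.
move=> fd gd fg.
have e : [tuple f j | j < n] = [tuple g j | j < n].
  apply: val_inj; apply: (irr_sorted_eq (leT := >%R) _ _
    (sorted_ord_tuple fd) (sorted_ord_tuple gd)).
  - by move=> a b c /= ab bc; exact: lt_trans bc ab.
  - by move=> a /=; rewrite ltxx.
  move=> a; apply/tnthP/tnthP => -[i ->]; rewrite tnth_mktuple.
    by exists ((w^-1)%g i); rewrite tnth_mktuple -fg permKV.
  by exists (w i); rewrite tnth_mktuple fg.
by move=> i; have := congr1 (fun t => tnth t i) e; rewrite !tnth_mktuple.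
Qed.

Lemma leq_double_sum (T : eqType) (s : seq T) (n : nat) (F : T -> 'I_n -> nat) x j :
  x \in s -> (F x j <= \sum_(y <- s) \sum_j F y j)%N.
Proof.
move=> xs; rewrite (big_rem x) //= (bigD1 j) //= -addnA; exact: leq_addr.
Qed.

Lemma poly_eq0_of_ray (R : realFieldType) (Q : {poly R}) (u0 : R) :
  (forall u, u0 <= u -> Q.[u] = 0) -> Q = 0.
Proof.
move=> Q0; apply/eqP/negPn/negP => Qn0.
pose rs := [seq u0 + n%:R | n <- iota 0 (size Q)].
suff : (size rs < size Q)%N by rewrite size_map size_iota ltnn.
apply: max_poly_roots => //.
  by apply/allP => _ /mapP[n _ ->]; rewrite /root Q0 // lerDl.
by rewrite map_inj_uniq ?iota_uniq // => m n /addrI/eqP; rewrite eqr_nat => /eqP.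
Qed.

(** Linear independence of the Schur functions is tested on the curve
    [x_i = u^(B^i)].  On it an alternant becomes a polynomial in [u] whose
    exponents are numbers written in base [B], the digits being the (nonnegative
    translates of the) exponents of the alternant.  For [B] large no two
    monomials of the finitely many alternants collide, so each coefficient can
    be read off. *)
Section Independence.
Variables (R : realFieldType) (N : nat) (s : seq (GT N)) (d : GT N -> R).
Hypothesis s_uniq : uniq s.

Let K := (\sum_(mu <- s) \sum_(j < N) absz (shifted mu j))%N.
Let B := K.*2.+2.
Let e (mu : GT N) (j : 'I_N) := absz (shifted mu j + K%:Z).

Let eE mu j : mu \in s -> (e mu j)%:Z = shifted mu j + K%:Z.
Proof.
move=> /(@leq_double_sum _ s N (fun mu j => absz (shifted mu j)) mu j).
by rewrite -/K /e; lia.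
Qed.

Let e_lt mu j : mu \in s -> (e mu j < B)%N.
Proof.
move=> /(@leq_double_sum _ s N (fun mu j => absz (shifted mu j)) mu j).
by rewrite -/K /e /B; lia.
Qed.

Let Q : {poly R} :=
  \sum_(mu <- s) d mu *: \det (\matrix_(i < N, j < N) 'X^(B ^ i * e mu j)).

Let coefQ mu0 : mu0 \in s -> Q`_(\sum_(i < N) B ^ i * e mu0 i)%N = d mu0.
Proof.
move=> mu0s; rewrite /Q coef_sum (bigD1_seq mu0) //=.
have coefdet mu : mu \in s ->
   (\det (\matrix_(i < N, j < N) 'X^(B ^ i * e mu j)) : {poly R})`_
      (\sum_(i < N) B ^ i * e mu0 i)%N = (mu == mu0)%:R.
  move=> mus; rewrite /determinant coef_sum.
  (* Equal exponents have equal digits, so w maps one decreasing sequence to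
     another. *)
  have key (w : 'S_N) : (\sum_(i < N) B ^ i * e mu0 i = \sum_(i < N) B ^ i * e mu (w i))%N ->
      mu = mu0 /\ w = 1%g.
    move=> /digits_inj eq_e.
    have {}eq_e i : shifted mu (w i) = shifted mu0 i.
      apply: (addIr K%:Z); rewrite -!eE // eq_e // => k; exact: e_lt.
    have sh : shifted mu =1 shifted mu0.
      by apply: (decreasing_perm _ _ eq_e) => i j; apply: shifted_lt.
    split; first by apply: eq_GT => j; have := sh j; rewrite /shifted => /addIr.
    by apply/permP => i; rewrite perm1; apply: (@shifted_inj _ mu); rewrite eq_e sh.
  have term (w : 'S_N) : ((-1) ^+ w * \prod_i (\matrix_(i < N, j < N) 'X^(B ^ i * e mu j)) i (w i)
       : {poly R})`_(\sum_(i < N) B ^ i * e mu0 i)%N = ((w == 1%g) && (mu == mu0))%:R.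
    under eq_bigr => i _ do rewrite mxE.
    rewrite -expr_sum mulr_sign.
    case: (eqVneq (\sum_(i < N) B ^ i * e mu0 i)%N (\sum_(i < N) B ^ i * e mu (w i))%N) => [E|ne].
      by have [Em w1] := key w E; rewrite -E Em w1 odd_perm1 coefXn !eqxx.
    have -> : (w == 1%g) && (mu == mu0) = false.
      apply/negbTE; apply: contra ne => /andP[/eqP-> /eqP->].
      by apply/eqP; apply: eq_bigr => i _; rewrite perm1.
    by case: (odd_perm w); rewrite ?coefN coefXn (negPf ne) ?oppr0.
  rewrite (bigD1 1%g) //= term eqxx big1 ?addr0 // => w /negPf w1.
  by rewrite term w1.
rewrite coefZ coefdet // eqxx mulr1 big_seq_cond big1 ?addr0 // => mu /andP[mus /negPf ne].
by rewrite coefZ coefdet // ne mulr0.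
Qed.

(** For [u > max(1, y)] the point with coordinates [u^(B^i)] is admissible, so
    the polynomial [Q] vanishes on a half-line. *)
Lemma schur_independent (y : R) :
  (forall x : 'I_N -> R, (forall i, x i != 0) -> injective (extend x y) ->
    \sum_(mu <- s) d mu * schur mu x = 0) ->
  forall mu, mu \in s -> d mu = 0.
Proof.
move=> h mu mus; rewrite -(coefQ mus).
suff -> : Q = 0 by rewrite coef0.
apply: (@poly_eq0_of_ray _ _ (2 + `|y|)) => u hu.
have u1 : 1 < u by have := normr_ge0 y; lra.
have u0 : 0 < u by lra.
have uy : y < u by have := ler_norm y; lra.
pose x (i : 'I_N) := u ^+ (B ^ i).
have x0 i : x i != 0 by rewrite expf_neq0 // gt_eqF.
have xy i : y < x i.
  apply: lt_le_trans uy _; rewrite -[leLHS]expr1 ler_eXn2l //.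
  by rewrite expn_gt0.
have x_inj : injective x.
  move=> i j /eqP; rewrite eq_le /x !ler_eXn2l // -eqn_leq eqn_exp2l // => /eqP.
  exact: val_inj.
have ext_inj : injective (extend x y).
  move=> i j; rewrite /extend.
  case: unliftP => [i' ->|->]; case: unliftP => [j' ->|->] //.
  - by move/x_inj ->.
  - by move=> E; have := xy i'; rewrite E ltxx.
  - by move=> E; have := xy j'; rewrite -E ltxx.
pose V := \prod_(i < N) \prod_(j < N | (i < j)%N) (x i - x j).
have Vn0 : V != 0.
  apply/prodf_neq0 => i _; apply/prodf_neq0 => j ij; rewrite subr_eq0.
  by apply: contraTneq ij => /x_inj ->; rewrite ltnn.
(* Schur functions become values of the polynomial alternants after clearing
   the Vandermonde denominator and translating all exponents by K. *)
pose c := \prod_i x i ^ K%:Z * V.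
transitivity (c * \sum_(nu <- s) d nu * schur nu x); last by rewrite h ?mulr0.
rewrite /Q horner_sum mulr_sumr.
apply: eq_big_seq => nu nus; rewrite hornerZ mulrCA; congr (_ * _).
rewrite -[LHS]/(horner_eval u _) -det_map_mx.
rewrite /c /schur -/V -mulrA [V * _]mulrC divfK //.
rewrite -(det_scale_rows (fun i => x i ^ K%:Z) (fun i j => x i ^ shifted nu j)).
congr (\det _); apply/matrixP => i j; rewrite !mxE /= /horner_eval hornerXn.
by rewrite -expfzDr // addrC -eE // /x -exprnP exprM.
Qed.

End Independence.

Lemma fsum_seq (R : zmodType) (T : choiceType) (s : seq T) (f : T -> R) :
  uniq s -> (forall x, x \notin s -> f x = 0) ->
  \sum_(x \in [set: T]) f x = \sum_(x <- s) f x.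
Proof.
move=> us f0; rewrite (fsbig_seq _ _ us); apply/esym; apply: fsbig_widen => // x /= [_ /negP xs].
exact: f0.
Qed.

Section LinkRow.
Variables (R : realType) (p : R) (N : nat) (lam : GT N.+1).
Hypotheses (p_gt0 : 0 < p) (p_neq1 : p != 1).

(** The explicit form of the links: the branching rule at [y = p^N], normalized
    by principal specializations. *)
Definition transition (mu : GT N) : R :=
  if mu \in below lam then
    (p ^+ N) ^ (weight lam - weight mu) * schur mu (geom p) / schur lam (geom p)
  else 0.

Lemma transition_ge0 mu : 0 <= transition mu.
Proof.
rewrite /transition; case: ifP => // _.
have sg n (nu : GT n) : 0 <= schur nu (geom p) by rewrite ltW ?schur_geom_gt0.
by apply: mulr_ge0; [apply: mulr_ge0|]; rewrite ?invr_ge0 // exprz_ge0 // exprn_ge0 // ltW.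
Qed.

Lemma transition_link_row : is_link_row p lam transition.
Proof.
split.
  apply: (@sub_finite_set _ _ [set` below lam]); last exact: finite_seq.
  by move=> mu /=; rewrite /transition; case: ifP => //; rewrite eqxx.
move=> x x0 x_inj.
have pN0 : p ^+ N != 0 by rewrite expf_neq0 ?gt_eqF.
rewrite schur_branching //; last first.
  move=> i; apply/eqP => E; have := x_inj (lift ord_max i) ord_max.
  rewrite extend_lift extend_max => /(_ E)/eqP.
  by rewrite eq_sym (negPf (neq_lift _ _)).
rewrite (fsum_seq (uniq_below lam)); last first.
  by move=> mu /negPf mub; rewrite /transition mub mul0r.
rewrite mulr_suml; apply: eq_big_seq => mu mub; rewrite /transition mub.
have := schur_geom_gt0 mu p_gt0 p_neq1; have := schur_geom_gt0 lam p_gt0 p_neq1.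
by move=> /gt_eqF l0 /gt_eqF m0; field; rewrite l0 m0.
Qed.

Lemma link_row_unique c : is_link_row p lam c -> c = transition.
Proof.
move=> [/finite_seqP[s1 E1] H1]; have [/finite_seqP[s2 E2] H2] := transition_link_row.
pose s := undup (s1 ++ s2).
have out1 mu : mu \notin s -> c mu = 0.
  rewrite mem_undup mem_cat negb_or => /andP[m1 _]; apply/eqP/negPn/negP => cn.
  by have : [set mu | c mu != 0] mu by []; rewrite E1 /= (negPf m1).
have out2 mu : mu \notin s -> transition mu = 0.
  rewrite mem_undup mem_cat negb_or => /andP[_ m2]; apply/eqP/negPn/negP => cn.
  by have : [set mu | transition mu != 0] mu by []; rewrite E2 /= (negPf m2).
have us : uniq s by exact: undup_uniq.
apply/funext => mu; have [mus|mus] := boolP (mu \in s); last by rewrite out1 ?out2.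
have /(_ mu mus) : forall mu, mu \in s -> (c mu - transition mu) / schur mu (geom p) = 0.
  apply: (schur_independent us (y := p ^+ N)) => x x0 x_inj.
  transitivity (\sum_(nu <- s) c nu * (schur nu x / schur nu (geom p)) -
                \sum_(nu <- s) transition nu * (schur nu x / schur nu (geom p))).
    by rewrite -sumrB; apply: eq_bigr => nu _; ring.
  have := H1 x x0 x_inj; rewrite (H2 x x0 x_inj) (fsum_seq us) => [|nu /out2 ->]; last exact: mul0r.
  by rewrite (fsum_seq us) => [->|nu /out1 ->]; rewrite ?subrr ?mul0r.
move/eqP; rewrite mulf_eq0 invr_eq0 (gt_eqF (schur_geom_gt0 mu p_gt0 p_neq1)) orbF.
by rewrite subr_eq0 => /eqP.
Qed.

(** The expansion is evaluated at the geometric progression itself. *)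
Lemma sum_transition : \sum_(mu <- below lam) transition mu = 1.
Proof.
have [_ H] := transition_link_row.
have geom_inj : injective (@geom R N.+1 p).
  move=> i j; rewrite /geom => /eqP; move: p_neq1; rewrite neq_lt eq_le => /orP[p1|p1].
    by rewrite !ler_iXn2l // andbC -eqn_leq => /eqP; apply: val_inj.
  by rewrite !ler_eXn2l // -eqn_leq => /eqP; apply: val_inj.
have ext : extend (geom p) (p ^+ N) = @geom R N.+1 p.
  apply/funext => i; rewrite /extend /geom; case: unliftP => [j ->|-> //].
  by rewrite lift_max.
have geom0 (i : 'I_N) : geom p i != 0 by rewrite expf_neq0 // gt_eqF.
have := H (geom p) geom0; rewrite ext => /(_ geom_inj).
rewrite divff ?gt_eqF ?schur_geom_gt0 // => ->.
rewrite (fsum_seq (uniq_below lam)) => [|mu /negPf mub]; last first.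
  by rewrite /transition mub mul0r.
by apply: eq_bigr => mu _; rewrite divff ?mulr1 ?gt_eqF ?schur_geom_gt0.
Qed.

End LinkRow.

Lemma linkE (R : realType) (q : R) (sigma : nat -> int) N (lam : GT N.+1) :
  0 < q ^ sigma N.+1 -> q ^ sigma N.+1 != 1 ->
  link q sigma lam = transition (q ^ sigma N.+1) lam.
Proof.
move=> p0 p1; apply: xget_unique => [|c]; first exact: transition_link_row.
exact: link_row_unique.
Qed.

(** * Moving one part of a signature *)

(** Beyond an index [m] where the tail of the geometric series is at most [1/2],
    the inequality [prod (1 - a_k) >= 1 - sum a_k] keeps the remaining product
    above [1/2]; the finitely many first factors are harmless. *)
Lemma qpochhammer_lower_bound (R : realType) (q : R) : 0 < q -> q < 1 ->
  exists2 c, 0 < c & forall n, c <= \prod_(k < n) (1 - q ^+ k.+1).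
Proof.
move=> q0 q1; have q0' := ltW q0.
have fac k : 0 < 1 - q ^+ k.+1 by rewrite subr_gt0 exprn_ilt1 // ltW.
have [m hm] : exists m, q ^+ m.+1 / (1 - q) <= 2^-1.
  have q1' : `|q| < 1 by rewrite ger0_norm // ltW.
  have := cvg_expr q1'.
  move=> /cvgrPdist_lt /(_ ((1 - q) / 2)); rewrite divr_gt0 ?subr_gt0 // => /(_ isT).
  move=> [m _ hm]; exists m.
  have := hm m.+1 (leqnSn m); rewrite sub0r normrN ger0_norm ?exprn_ge0 // => h.
  by apply: ltW; rewrite ltr_pdivrMr ?subr_gt0 // mulrC.
have tail n : 1 - q ^+ m.+1 * (1 - q ^+ n) / (1 - q) <=
    \prod_(k < n) (1 - q ^+ (m + k).+1).
  elim: n => [|n IHn]; first by rewrite big_ord0 expr0 subrr mulr0 mul0r subr0.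
  rewrite big_ord_recr /=.
  apply: le_trans (_ : (1 - q ^+ m.+1 * (1 - q ^+ n) / (1 - q)) * (1 - q ^+ (m + n).+1) <= _).
    rewrite -addSn exprD [q ^+ n.+1]exprS.
    have : 0 <= q ^+ m.+1 * (1 - q ^+ n) / (1 - q) * (q ^+ m.+1 * q ^+ n).
      have qn : 0 <= 1 - q ^+ n by rewrite subr_ge0 exprn_ile1 // ltW.
      have q1i : 0 <= (1 - q)^-1 by rewrite invr_ge0 subr_ge0 ltW.
      by do ![apply: mulr_ge0]; rewrite ?exprn_ge0.
    have q1n : 1 - q != 0 by rewrite subr_eq0 gt_eqF.
    have -> : q ^+ m.+1 * (1 - q * q ^+ n) / (1 - q) =
        q ^+ m.+1 * (1 - q ^+ n) / (1 - q) + q ^+ m.+1 * q ^+ n by field.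
    set a := _ / _; set b := _ * q ^+ n => ab.
    by rewrite mulrBr mulr1 mulrBl mul1r; lra.
  by rewrite ler_wpM2r // ltW.
exists ((\prod_(k < m) (1 - q ^+ k.+1)) / 2).
  by rewrite divr_gt0 // prodr_gt0.
have half n : 2^-1 <= \prod_(k < n) (1 - q ^+ (m + k).+1).
  apply: le_trans (tail n); rewrite lerBrDr.
  have : q ^+ m.+1 * (1 - q ^+ n) / (1 - q) <= q ^+ m.+1 / (1 - q).
    rewrite ler_pM2r ?invr_gt0 ?subr_gt0 // ler_piMr ?exprn_ge0 //.
    by rewrite gerBl exprn_ge0.
  by lra.
have P0 n : 0 <= \prod_(k < n) (1 - q ^+ k.+1) by apply: prodr_ge0 => k _; rewrite ltW.
move=> n; case: (leqP m n) => mn.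
  rewrite -(subnKC mn) big_split_ord; apply: ler_wpM2l; [exact: P0|exact: half].
apply: le_trans (_ : \prod_(k < m) (1 - q ^+ k.+1) <= _).
  by apply: ler_piMr; [exact: P0 | rewrite invf_le1 // ler1n].
rewrite -(subnKC (ltnW mn)) big_split_ord; apply: ler_piMr; first exact: P0.
by apply: prodr_ile1 => k _; rewrite ltW //= gerBl exprn_ge0.
Qed.

Lemma ler_sum_uniq_sub (R : numDomainType) (T : eqType) (s t : seq T) (F : T -> R) :
  uniq s -> uniq t -> {subset s <= t} -> (forall x, 0 <= F x) ->
  \sum_(x <- s) F x <= \sum_(x <- t) F x.
Proof.
move=> us ut st F0.
have -> : \sum_(x <- s) F x = \sum_(x <- t | x \in s) F x.
  rewrite -[RHS]big_filter; apply: perm_big; apply: uniq_perm; rewrite ?filter_uniq //.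
  by move=> x; rewrite mem_filter andb_idr //; apply: st.
rewrite [leRHS](bigID (mem s)) /= lerDl; exact: sumr_ge0.
Qed.

Lemma prod_pairs_through (R : comPzRingType) n (i : 'I_n) (g : 'I_n -> R) :
  \prod_(a < n) \prod_(b < n | (a < b)%N)
    (if a == i then g b else if b == i then g a else 1) =
  \prod_(j < n | j != i) g j.
Proof.
rewrite (bigD1 i) //= eqxx [RHS](bigID (fun j : 'I_n => (i < j)%N)) /=; congr (_ * _).
  by apply: eq_bigl => j; rewrite andb_idl // => ij; apply: contraTneq ij => ->; rewrite ltnn.
rewrite [RHS]big_mkcondr; apply: eq_bigr => a ai; rewrite (negPf ai) -leqNgt.
have -> : (a <= i)%N = (a < i)%N by rewrite leq_eqVlt -[(_ == _ :> nat)]/(a == i) (negPf ai).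
case: ifP => ltai.
  rewrite (bigD1 i) //= eqxx big1 ?mulr1 // => b /andP[_ /negPf ->] //.
rewrite big1 // => b ab; case: eqP => // bi; by rewrite -bi ab in ltai.
Qed.

(** When two signatures differ only in the part [i], the ratio of their
    principal specializations involves only the pairs containing [i]. *)
Lemma schur_geom_le (R : realFieldType) n (mu nu : GT n) (i : 'I_n) (p : R)
    (g : 'I_n -> R) :
  0 < p -> p != 1 ->
  (forall j, j != i -> tnth mu j = tnth nu j) ->
  (forall j, j != i -> `|p ^ shifted mu j - p ^ shifted mu i| <=
                       g j * `|p ^ shifted nu j - p ^ shifted nu i|) ->
  schur mu (geom p) <= \prod_(j < n | j != i) g j * schur nu (geom p).
Proof.
move=> p0 p1 off hg; rewrite -prod_pairs_through !schur_geom -big_split /=.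
have f0 (kap : GT n) (a b : 'I_n) := @geom_factor_gt0 R n kap p a b p0 p1.
apply: ler_prod => a _; apply/andP; split.
  by apply: prodr_ge0 => b ab; apply: ltW; apply: f0.
rewrite -big_split; apply: ler_prod => b ab; rewrite (ltW (f0 mu _ _ ab)) /=.
rewrite -[leLHS](ger0_norm (ltW (f0 mu _ _ ab))).
rewrite -[X in _ <= _ * X](ger0_norm (ltW (f0 nu _ _ ab))) !normrM mulrA.
rewrite ler_wpM2r //.
have sh j : j != i -> shifted mu j = shifted nu j by move=> ji; rewrite /shifted off.
case: eqP ab => [->|/eqP ai] ab.
  by apply: hg; apply: contraTneq ab => ->; rewrite ltnn.
case: eqP => [bi|/eqP bi]; last by rewrite mul1r !sh.
by subst b; rewrite distrC [X in _ <= _ * X]distrC; exact: hg.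
Qed.

Section ScalarBounds.
Variables (R : realFieldType) (q : R).
Hypotheses (q_gt0 : 0 < q) (q_lt1 : q < 1).
Let r := q^-1.
Let r1 : 1 < r. Proof. by rewrite /r invf_cp1. Qed.
Let r0 : 0 < r. Proof. exact: lt_trans r1. Qed.

(** The distance after raising the larger power by [e] steps is at most that
    power itself, while before it was at least the fraction [1 - q^k] of the
    larger power, the exponents being [k] apart. *)
Lemma dist_far (a s : int) (e k : nat) : (0 < k)%N -> k%:Z <= a - s ->
  `|r ^ s - r ^ (a + e%:Z)| <= r ^+ e / (1 - q ^+ k) * `|r ^ s - r ^ a|.
Proof.
move=> k0 ka; have qk : 0 < 1 - q ^+ k by rewrite subr_gt0 exprn_ilt1 ?ltW // -lt0n.
have sa : r ^ s <= r ^ a * q ^+ k.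
  have -> : q ^+ k = r ^ (- k%:Z) by rewrite /r exprz_inv opprK.
  by rewrite -expfzDr ?gt_eqF // ler_eXz2l //; lia.
have ra : 0 < r ^ a by rewrite exprz_gt0.
have re : 1 <= r ^+ e by rewrite exprn_ege1 // ltW.
have rs : 0 < r ^ s by rewrite exprz_gt0.
have sa' : r ^ s <= r ^ a by apply: le_trans sa _; rewrite ger_pMr // exprn_ile1 // ltW.
rewrite expfzDr ?gt_eqF // -exprnP distrC (distrC (r ^ s)).
rewrite !ger0_norm ?subr_ge0 //; last by apply: le_trans sa' _; rewrite ler_peMr // ltW.
apply: le_trans (_ : r ^ a * r ^+ e <= _); first by rewrite gerBl ltW.
rewrite -mulrA mulrC ler_wpM2l ?(le_trans ler01) // ler_pdivlMl //; lra.
Qed.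

(** Raising the smaller power, without overtaking, reduces the distance. *)
Lemma dist_near (a s : int) (e : nat) : a + e%:Z <= s ->
  `|r ^ s - r ^ (a + e%:Z)| <= `|r ^ s - r ^ a|.
Proof.
move=> aes; have ae : r ^ a <= r ^ (a + e%:Z) by rewrite ler_eXz2l //; lia.
have es : r ^ (a + e%:Z) <= r ^ s by rewrite ler_eXz2l.
rewrite !ger0_norm ?subr_ge0 //; last exact: le_trans es.
by rewrite lerB.
Qed.

End ScalarBounds.

(** * Concentration of a single link *)

Lemma weight_change N (mu nu : GT N) (i : 'I_N) :
  (forall j, j != i -> tnth mu j = tnth nu j) ->
  weight mu - weight nu = tnth mu i - tnth nu i.
Proof.
move=> off; rewrite /weight (bigD1 i) //= [in X in _ - X](bigD1 i) //=.
rewrite (eq_bigr (tnth nu)) => [|j ji]; last exact: off.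
by ring.
Qed.

Lemma transition_ratio (R : realType) (p : R) N (lam : GT N.+1) (mu nu : GT N) (G : R) :
  0 < p -> p != 1 -> mu \in below lam -> nu \in below lam ->
  schur mu (geom p) <= G * schur nu (geom p) ->
  transition p lam mu <= (p ^+ N) ^ (weight nu - weight mu) * G * transition p lam nu.
Proof.
move=> p0 p1 mub nub le_mu; rewrite /transition mub nub.
have pN : 0 < p ^+ N by rewrite exprn_gt0.
have -> : weight lam - weight mu = (weight nu - weight mu) + (weight lam - weight nu) by ring.
rewrite expfzDr ?gt_eqF //.
have l0 := schur_geom_gt0 lam p0 p1.
set a := _ ^ (weight nu - _); set b := _ ^ (weight lam - _).
rewrite [leRHS](_ : _ = a * b * (G * schur nu (geom p)) / schur lam (geom p)); last by ring.
rewrite ler_wpM2r ?invr_ge0 ?(ltW l0) // ler_wpM2l // mulr_ge0 //.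
  by rewrite exprz_ge0 // ltW.
by rewrite exprz_ge0 // ltW.
Qed.

(** In this section [c] is a uniform lower bound for the products of the
    [1 - q^n]; it controls the interaction of one part with all the others,
    because the shifted parts are distinct integers. *)
Section OneStep.
Variables (R : realType) (q c : R).
Hypotheses (q_gt0 : 0 < q) (q_lt1 : q < 1) (c_gt0 : 0 < c).
Hypothesis c_le : forall n, c <= \prod_(k < n) (1 - q ^+ k.+1).

Lemma prod_far_le (e m : nat) :
  \prod_(k < m) (q^-1 ^+ e / (1 - q ^+ k.+1)) <= q^-1 ^+ (e * m) / c.
Proof.
rewrite prodf_div prodr_const card_ord -exprM.
have P0 : 0 < \prod_(k < m) (1 - q ^+ k.+1) by apply: lt_le_trans (c_le m).
by rewrite ler_pM2l ?exprn_gt0 ?invr_gt0 // lef_pV2 ?posrE.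
Qed.

Lemma prod_after_le n (i : 'I_n) (e : nat) :
  \prod_(j < n | j != i) (if (i < j)%N then q^-1 ^+ e / (1 - q ^+ (j - i)) else 1)
    <= q^-1 ^+ (e * (n - i.+1)) / c.
Proof.
apply: le_trans (prod_far_le e (n - i.+1)); rewrite -big_mkcondr /=.
rewrite (eq_bigl (fun j : 'I_n => (i.+1 <= j)%N)) => [|j]; last first.
  by rewrite andb_idl // => ij; apply: contraTneq ij => ->; rewrite ltnn.
rewrite -(big_geq_mkord _ _ xpredT (fun j => q^-1 ^+ e / (1 - q ^+ (j - i)))) -{1}[i.+1]add0n.
rewrite big_addn big_mkord le_eqVlt; apply/orP; left; apply/eqP.
by apply: eq_bigr => k _; rewrite addnS subSn ?leq_addl // addnK.
Qed.

Lemma prod_before_le n (i : 'I_n) (e : nat) :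
  \prod_(j < n | j != i) (if (j < i)%N then q^-1 ^+ e / (1 - q ^+ (i - j)) else 1)
    <= q^-1 ^+ (e * i) / c.
Proof.
apply: le_trans (prod_far_le e i); rewrite -big_mkcondr /=.
rewrite (eq_bigl (fun j : 'I_n => (j < i)%N)) => [|j]; last first.
  by rewrite andb_idl // => ij; apply: contraTneq ij => ->; rewrite ltnn.
rewrite -(big_ord_widen _ (fun j => q^-1 ^+ e / (1 - q ^+ (i - j))) (ltnW (ltn_ord i))).
rewrite (reindex_inj rev_ord_inj) /= le_eqVlt; apply/orP; left; apply/eqP.
by apply: eq_bigr => k _; rewrite subKn.
Qed.

(** For [p = 1/q], the parts after [i] are far from [i] in the sense of
    [dist_far] and the parts before [i] are near; each of the [n - i - 1] far
    ones costs a factor [q^(-e)].  Below, for [p = q], the roles of the two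
    sides are exchanged. *)
Lemma schur_geom_lower n (mu nu : GT n) (i : 'I_n) (e : nat) :
  (forall j, j != i -> tnth mu j = tnth nu j) -> tnth mu i = tnth nu i + e%:Z ->
  schur mu (geom q^-1) <= q^-1 ^+ (e * (n - i.+1)) / c * schur nu (geom q^-1).
Proof.
move=> off at_i; have r1 : 1 < q^-1 by rewrite invf_cp1.
have r0 : 0 < q^-1 by rewrite invr_gt0.
have rn1 : q^-1 != 1 by rewrite gt_eqF.
apply: le_trans (_ : _ <= (\prod_(j < n | j != i)
    (if (i < j)%N then q^-1 ^+ e / (1 - q ^+ (j - i)) else 1)) * schur nu (geom q^-1)) _.
  apply: schur_geom_le => // j ji.
  have -> : shifted mu i = shifted nu i + e%:Z by rewrite /shifted at_i; ring.
  have -> : shifted mu j = shifted nu j by rewrite /shifted off.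
  case: ifP => ij.
    by apply: dist_far; rewrite ?subn_gt0 //; apply: shifted_gap; apply: ltnW.
  rewrite mul1r; apply: dist_near => //.
  have lt_ji : (j < i)%N by rewrite ltn_neqAle -[(_ == _ :> nat)]/(j == i) ji leqNgt ij.
  have := shifted_lt mu lt_ji; rewrite /shifted at_i off //; lia.
rewrite ler_wpM2r ?prod_after_le //; apply: ltW; exact: schur_geom_gt0.
Qed.

Lemma schur_geom_raise n (mu nu : GT n) (i : 'I_n) (e : nat) :
  (forall j, j != i -> tnth mu j = tnth nu j) -> tnth mu i = tnth nu i - e%:Z ->
  schur mu (geom q) <= q^-1 ^+ (e * i) / c * schur nu (geom q).
Proof.
move=> off at_i.
have qn1 : q != 1 by rewrite lt_eqF.
have qE a : q ^ a = q^-1 ^ (- a) by rewrite exprz_inv opprK.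
apply: le_trans (_ : _ <= (\prod_(j < n | j != i)
    (if (j < i)%N then q^-1 ^+ e / (1 - q ^+ (i - j)) else 1)) * schur nu (geom q)) _.
  apply: schur_geom_le => // j ji; rewrite !qE.
  have -> : - shifted mu i = - shifted nu i + e%:Z by rewrite /shifted at_i; ring.
  have -> : shifted mu j = shifted nu j by rewrite /shifted off.
  case: ifP => ij.
    apply: dist_far; rewrite ?subn_gt0 //.
    by rewrite opprK addrC; apply: shifted_gap; apply: ltnW.
  rewrite mul1r; apply: dist_near => //.
  have lt_ij : (i < j)%N by rewrite ltn_neqAle eq_sym -[(_ == _ :> nat)]/(j == i) ji leqNgt ij.
  have := shifted_lt mu lt_ij; rewrite /shifted at_i off //; lia.
rewrite ler_wpM2r ?prod_before_le //; apply: ltW; exact: schur_geom_gt0.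
Qed.

(** Here [v] is the value that the part [i] prefers, one of the two ends of its
    interval, and each unit of distance from [v] costs a factor [theta].  The
    sign [sg] tells on which side of [v] the interval lies. *)
Section Concentration.
Variables (p theta : R) (N : nat) (lam : GT N.+1) (i : 'I_N) (v sg : int).
Hypotheses (p_gt0 : 0 < p) (p_neq1 : p != 1).
Hypotheses (theta_ge0 : 0 <= theta) (theta_le : theta <= q).
Hypothesis v_mid : tnth lam (lift ord0 i) <= v <= tnth lam (lift ord_max i).

Definition excess (mu : GT N) : nat := `|tnth mu i - v|%N.

Definition reset (mu : GT N) : GT N :=
  mkGT (fun j => if j == i then v else tnth mu j).

Lemma tnth_reset mu j : mu \in below lam ->
  tnth (reset mu) j = if j == i then v else tnth mu j.
Proof.
rewrite mem_below => /forallP muI; apply: (@tnth_mkGT_interlaces _ lam).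
by apply/forallP => k; case: eqP => [->|].
Qed.

Lemma reset_below mu : mu \in below lam -> reset mu \in below lam.
Proof.
move=> mub; rewrite mem_below; apply/forallP => j; rewrite tnth_reset //.
by case: eqP => [->|_] //; move: j; apply/forallP; rewrite -/(interlaces _ _) -mem_below.
Qed.

Hypothesis one_sided : forall mu, mu \in below lam -> tnth mu i = v + sg * (excess mu)%:Z.
Hypothesis transition_reset : forall mu, mu \in below lam ->
  transition p lam mu <= theta ^+ excess mu / c * transition p lam (reset mu).

(** On the signatures at a given distance from [v], [reset] is injective, so
    their total mass is at most [theta^k / c] times the mass of a set of
    signatures, that is, at most [theta^k / c]. *)
Lemma excess_mass_le k :
  \sum_(mu <- below lam | excess mu == k) transition p lam mu <= theta ^+ k / c.
Proof.
apply: le_trans (_ : \sum_(mu <- below lam | excess mu == k)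
    theta ^+ k / c * transition p lam (reset mu) <= _).
  rewrite big_seq_cond [leRHS]big_seq_cond.
  by apply: ler_sum => mu /andP[mub /eqP <-]; apply: transition_reset.
rewrite -mulr_sumr ler_piMr // ?divr_ge0 ?exprn_ge0 ?(ltW c_gt0) //.
rewrite -(sum_transition lam p_gt0 p_neq1) -big_filter.
rewrite -[leLHS](big_map reset xpredT (transition p lam)).
apply: ler_sum_uniq_sub.
- rewrite map_inj_in_uniq ?filter_uniq ?uniq_below // => mu nu.
  rewrite !mem_filter => /andP[/eqP Em mub] /andP[/eqP En nub] E.
  apply: eq_GT => j; have := congr1 (fun kap : GT N => tnth kap j) E.
  rewrite !tnth_reset //; case: eqP => // -> _.
  by rewrite !one_sided // Em En.
- exact: uniq_below.
- by move=> _ /mapP[mu + ->]; rewrite mem_filter => /andP[_]; apply: reset_below.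
by move=> mu; apply: transition_ge0.
Qed.

Lemma move_mass_le :
  \sum_(mu <- below lam | tnth mu i != v) transition p lam mu
    <= theta / (c * (1 - q)).
Proof.
pose D := (\max_(mu <- below lam) excess mu)%N.
apply: le_trans (_ : \sum_(k < D) theta ^+ k.+1 / c <= _); last first.
  rewrite -mulr_suml invfM mulrA mulrAC ler_wpM2r ?invr_ge0 ?(ltW c_gt0) //.
  rewrite ler_pdivlMr ?subr_gt0 //.
  under eq_bigr => k _ do rewrite exprS.
  rewrite -mulr_sumr -mulrA ler_piMr //.
  apply: le_trans (_ : (\sum_(k < D) theta ^+ k) * (1 - theta) <= _).
    by rewrite ler_wpM2l ?lerB // sumr_ge0 // => k _; rewrite exprn_ge0.
  rewrite mulrC -opprB mulNr -subrX1 opprB gerBl exprn_ge0 //.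
apply: le_trans (_ : \sum_(k < D) \sum_(mu <- below lam | excess mu == k.+1)
    transition p lam mu <= _); last first.
  by apply: ler_sum => k _; apply: excess_mass_le.
rewrite (exchange_big_dep xpredT) //=.
rewrite big_seq_cond big_mkcond [leRHS]big_seq_cond [leRHS]big_mkcond /=.
apply: ler_sum => mu _; case: (boolP (mu \in below lam)) => //= mub.
have T0 : 0 <= transition p lam mu by apply: transition_ge0.
case: ifP => [ne|_]; last exact: sumr_ge0.
have e0 : (0 < excess mu)%N by rewrite /excess absz_gt0 subr_eq0.
have eD : ((excess mu).-1 < D)%N by rewrite prednK // /D; apply: leq_bigmax_seq.
by rewrite (bigD1 (Ordinal eD)) /= ?prednK // lerDl sumr_ge0.
Qed.

End Concentration.

(** The power [q^((i+1) e)] is what remains of the weight [q^(N e)] of the link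
    after the [N - i - 1] factors [q^(-e)] of [schur_geom_lower]; indices are
    counted from [0]. *)
Lemma step_minus N (lam : GT N.+1) (i : 'I_N) :
  \sum_(mu <- below lam | tnth mu i != tnth lam (lift ord0 i)) transition q^-1 lam mu
    <= q ^+ i.+1 / (c * (1 - q)).
Proof.
have r1 : 1 < q^-1 by rewrite invf_cp1.
have r0 : 0 < q^-1 by rewrite invr_gt0.
have rn1 : q^-1 != 1 by rewrite gt_eqF.
have vI : tnth lam (lift ord0 i) <= tnth lam (lift ord0 i) <= tnth lam (lift ord_max i).
  by rewrite lexx tnth_noninc // lift0 lift_max.
have side mu : mu \in below lam ->
    tnth mu i = tnth lam (lift ord0 i) + (excess i (tnth lam (lift ord0 i)) mu)%:Z.
  by rewrite mem_below => /forallP/(_ i) muI; rewrite /excess; lia.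
apply: (@move_mass_le q^-1 (q ^+ i.+1) N lam i (tnth lam (lift ord0 i)) 1) => //.
- by rewrite exprn_ge0 // ltW.
- by rewrite exprS ger_pMr // exprn_ile1 // ltW.
- by move=> mu mub; rewrite mul1r side.
move=> mu mub; set v := tnth lam _ in vI side *; set e := excess i v mu.
have off j : j != i -> tnth mu j = tnth (reset i v mu) j.
  by move=> /negPf ji; rewrite (tnth_reset vI) ?ji.
have at_i : tnth (reset i v mu) i = v by rewrite (tnth_reset vI) ?eqxx.
have := transition_ratio r0 rn1 mub (reset_below vI mub)
  (schur_geom_lower off (_ : tnth mu i = _ + e%:Z)).
rewrite at_i => /(_ (side _ mub)) /le_trans; apply.
rewrite mulrA ler_wpM2r ?transition_ge0 // ler_wpM2r ?invr_ge0 ?(ltW c_gt0) //.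
have -> : weight (reset i v mu) - weight mu = - e%:Z.
  by rewrite -opprB (weight_change off) at_i side //; ring.
rewrite le_eqVlt; apply/orP; left; apply/eqP.
have qE n : q ^+ n = q^-1 ^ (- n%:Z) by rewrite exprz_inv opprK.
rewrite -exprM [RHS]qE !exprnP exprz_exp -expfzDr ?gt_eqF //; congr (_ ^ _).
by have := ltn_ord i; nia.
Qed.

(** As for [step_minus], with [i] factors [q^(-e)] coming from
    [schur_geom_raise]. *)
Lemma step_plus N (lam : GT N.+1) (i : 'I_N) :
  \sum_(mu <- below lam | tnth mu i != tnth lam (lift ord_max i)) transition q lam mu
    <= q ^+ (N - i) / (c * (1 - q)).
Proof.
have qn1 : q != 1 by rewrite lt_eqF.
have vI : tnth lam (lift ord0 i) <= tnth lam (lift ord_max i) <= tnth lam (lift ord_max i).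
  by rewrite lexx tnth_noninc // lift0 lift_max.
have side mu : mu \in below lam ->
    tnth mu i = tnth lam (lift ord_max i) - (excess i (tnth lam (lift ord_max i)) mu)%:Z.
  by rewrite mem_below => /forallP/(_ i) muI; rewrite /excess; lia.
apply: (@move_mass_le q (q ^+ (N - i)) N lam i (tnth lam (lift ord_max i)) (-1)) => //.
- by rewrite exprn_ge0 // ltW.
- by rewrite -(subnSK (ltn_ord i)) exprS ger_pMr // exprn_ile1 // ltW.
- by move=> mu mub; rewrite mulN1r side.
move=> mu mub; set v := tnth lam (lift ord_max i) in vI side *; set e := excess i v mu.
have off j : j != i -> tnth mu j = tnth (reset i v mu) j.
  by move=> /negPf ji; rewrite (tnth_reset vI) ?ji.
have at_i : tnth (reset i v mu) i = v by rewrite (tnth_reset vI) ?eqxx.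
have := transition_ratio q_gt0 qn1 mub (reset_below vI mub)
  (schur_geom_raise off (_ : tnth mu i = _ - e%:Z)).
rewrite at_i => /(_ (side _ mub)) /le_trans; apply.
rewrite mulrA ler_wpM2r ?transition_ge0 // ler_wpM2r ?invr_ge0 ?(ltW c_gt0) //.
have -> : weight (reset i v mu) - weight mu = e%:Z.
  by rewrite -opprB (weight_change off) at_i side //; ring.
rewrite le_eqVlt; apply/orP; left; apply/eqP.
have rE n : q^-1 ^+ n = q ^ (- n%:Z) by rewrite -exprz_inv.
rewrite -exprM rE !exprnP exprz_exp -expfzDr ?gt_eqF //; congr (_ ^ _).
by have := ltn_ord i; nia.
Qed.

End OneStep.

(** * Positions along the sequence of signs *)

Lemma part_tnth n (lam : GT n) (z : int) (i : 'I_n) : z = i.+1%:Z -> part lam z = tnth lam i.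
Proof.
move=> ->; rewrite /part (_ : 0 < i.+1%:Z) // (tnth_nth 0); congr (nth 0 lam _).
by lia.
Qed.

Lemma part_ord n (z : int) : 1 <= z <= n%:Z -> exists i : 'I_n, z = i.+1%:Z.
Proof.
move=> zn; have lt : (`|z|.-1 < n)%N by lia.
by exists (Ordinal lt) => /=; lia.
Qed.

Lemma count_iota1_mono (P : pred nat) m n : (m <= n)%N ->
  (count P (iota 1 m) <= count P (iota 1 n))%N.
Proof. by move=> /subnKC <-; rewrite iotaD count_cat leq_addr. Qed.

(** There is always a further element of the set, which raises the count. *)
Lemma count_iota1_unbounded (P : pred nat) :
  infinite_set [set i : nat | (0 < i)%N /\ P i] ->
  forall m, exists N, forall n, (N <= n)%N -> (m <= count P (iota 1 n))%N.
Proof.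
move=> Pinf; elim=> [|m [N0 hN0]]; first by exists 0%N.
have [i [i0 Pi] Ni] : exists2 i : nat, (0 < i)%N /\ P i & (N0 < i)%N.
  apply: contrapT => none; apply: Pinf.
  apply: (@sub_finite_set _ _ [set` iota 0 N0.+1]); last exact: finite_seq.
  move=> i iP; change (is_true (i \in iota 0 N0.+1)).
  rewrite mem_iota add0n /= ltnS leqNgt; apply/negP => Ni.
  by apply: none; exists i.
exists i => n iin.
apply: leq_trans (count_iota1_mono P iin); case: i i0 Pi Ni {iin} => // i _ Pi Ni.
rewrite -[i.+1]addn1 iotaD count_cat /= add1n Pi addn1 ltnS; exact: hN0.
Qed.

Section Stabilization.
Variables (sigma : nat -> int) (t : int -> int).

Local Notation b := (bfun sigma).

Lemma bfunS N : b N.+1 = (b N + (sigma N.+1 == -1)%R)%N.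
Proof. by rewrite /bfun -[N.+1]addn1 iotaD count_cat /= add1n addn0 addn1. Qed.

Lemma bfun_le N : (b N <= N)%N.
Proof. by rewrite /bfun -[leqRHS](size_iota 1); apply: count_size. Qed.

Hypothesis sigma_plus : infinite_set [set i : nat | (0 < i)%N /\ sigma i = 1].
Hypothesis sigma_minus : infinite_set [set i : nat | (0 < i)%N /\ sigma i = -1].

Lemma bfun_cvgy : b n @[n --> \oo] --> \oo.
Proof.
apply/cvgnyPge => m.
have [|N hN] := @count_iota1_unbounded (fun i => sigma i == -1) _ m.
  by apply: sub_infinite_set sigma_minus => i [i0 si]; split => //; apply/eqP.
by exists N => // n; apply: hN.
Qed.

Lemma bfun_co_cvgy : (n - b n)%N @[n --> \oo] --> \oo.
Proof.
apply/cvgnyPge => m.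
have [|N hN] := @count_iota1_unbounded (fun i => sigma i == 1) _ m.
  by apply: sub_infinite_set sigma_plus => i [i0 si]; split => //; apply/eqP.
exists N => // n /hN /leq_trans; apply => /=.
rewrite leq_subRL ?bfun_le // -[leqRHS](size_iota 1) /bfun.
rewrite -(count_predC (fun i => sigma i == -1)) leq_add2l.
by apply: sub_count => i /= /eqP ->.
Qed.

(** The position [b(N) + k] lies eventually inside the signature, since it moves
    away from both of its ends. *)
Lemma near_index (k : int) : \forall N \near \oo, 1 <= (b N)%:Z + k <= N%:Z.
Proof.
have /cvgnyPge/(_ `|k|.+1) := bfun_cvgy; have /cvgnyPge/(_ `|k|%N) := bfun_co_cvgy.
by apply: filterS2 => N /= h1 h2; have := bfun_le N; lia.
Qed.

Hypothesis t_nondec : forall i j : int, i <= j -> t i <= t j.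

(** The window of [t] for which the position [b(N) + 1 - i] carries [t i]; it
    witnesses that sequences stabilizing to [t] exist. *)
Definition truncation (N : nat) : GT N :=
  mkGT (fun j : 'I_N => t ((b N)%:Z - j%:Z)).

Lemma part_truncation N (k : int) : 1 <= (b N)%:Z + k <= N%:Z ->
  part (truncation N) ((b N)%:Z + k) = t (1 - k).
Proof.
move=> /part_ord[i Ei]; rewrite (part_tnth _ Ei) tnth_mkGT.
  by congr t; lia.
by move=> j j' jj'; apply: t_nondec; lia.
Qed.

Lemma truncation_stabilizes : b_stabilizes sigma truncation t.
Proof.
move=> i; apply: cvg_near_cst; apply: filterS (near_index (1 - i)) => N hN.
by have := part_truncation hN; rewrite addrA => ->; congr t; ring.
Qed.

End Stabilization.

(** * Following one part down the chain *)

Section Chain.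
Variables (R : realType) (q c : R) (sigma : nat -> int).
Hypotheses (q_gt0 : 0 < q) (q_lt1 : q < 1) (c_gt0 : 0 < c).
Hypothesis c_le : forall n, c <= \prod_(k < n) (1 - q ^+ k.+1).
Hypothesis sigma_pm1 : forall i, (0 < i)%N -> sigma i = 1 \/ sigma i = -1.

Local Notation b := (bfun sigma).
Local Notation kernel := (kernel_prod q sigma).

Lemma specialization_gt0 N : 0 < q ^ sigma N.+1.
Proof. exact: exprz_gt0. Qed.

Lemma specialization_neq1 N : q ^ sigma N.+1 != 1.
Proof.
have [->|->] := @sigma_pm1 N.+1 isT; first by rewrite expr1z lt_eqF.
by rewrite gt_eqF // -[q]invrK exprN1 invrK invf_cp1.
Qed.

Lemma kernelS N L (lam : GT N.+1) (nu : GT L) : (L <= N)%N ->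
  kernel lam nu = \sum_(kap <- below lam) transition (q ^ sigma N.+1) lam kap * kernel kap nu.
Proof.
move=> LN; rewrite /= LN linkE ?specialization_gt0 ?specialization_neq1 //.
apply: fsum_seq; first exact: uniq_below.
by move=> kap /negPf kb; rewrite /transition kb mul0r.
Qed.

Lemma kernel_above N L (lam : GT N) (nu : GT L) : (N <= L)%N ->
  kernel lam nu = ((lam : seq int) == (nu : seq int))%:R.
Proof. by case: N lam => [|N] lam //= NL; rewrite leqNgt NL. Qed.

Lemma kernel_ge0 N L (lam : GT N) (nu : GT L) : 0 <= kernel lam nu.
Proof.
elim: N lam => [|N IHN] lam; first by rewrite kernel_above.
case: (leqP L N) => LN; last by rewrite kernel_above.
rewrite kernelS //; apply: sumr_ge0 => kap _; apply: mulr_ge0 => //.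
exact: transition_ge0 (specialization_gt0 N) (specialization_neq1 N) _.
Qed.

Lemma kernel_mass N L (lam : GT N) (s : seq (GT L)) : uniq s ->
  \sum_(nu <- s) kernel lam nu <= 1.
Proof.
move=> us; have base n (kap : GT n) :
    \sum_(nu <- s) ((kap : seq int) == (nu : seq int))%:R <= 1 :> R.
  pose f (nu : GT L) : seq int := nu.
  have uf : uniq (map f s).
    by rewrite map_inj_uniq // => mu nu /val_inj/val_inj.
  have -> : \sum_(nu <- s) ((kap : seq int) == (nu : seq int))%:R =
      (count_mem (kap : seq int) (map f s))%:R :> R.
    rewrite count_map -sum1_count [in RHS]big_mkcond natr_sum; apply: eq_bigr => nu _ /=.
    by rewrite eq_sym; case: eqP.
  by rewrite count_uniq_mem // lern1 leq_b1.
elim: N lam => [|N IHN] lam.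
  by under eq_bigr do rewrite kernel_above //.
case: (leqP L N) => LN; last by under eq_bigr do rewrite kernel_above //.
under eq_bigr do rewrite kernelS //.
rewrite exchange_big /= -(sum_transition lam (specialization_gt0 N) (specialization_neq1 N)).
apply: ler_sum => kap _; rewrite -mulr_sumr ler_piMr //.
exact: transition_ge0 (specialization_gt0 N) (specialization_neq1 N) _.
Qed.

Variable k : int.

(** The total error of all the links from level [N] upwards, in closed form: the
    two powers are the leading terms of the geometric series of the errors of
    [step_minus] and [step_plus], and one factor [1 - q] of the denominator sums
    these series. *)
Definition escape (N : nat) : R :=
  (q ^ ((b N)%:Z + k) + q ^ (N%:Z - (b N)%:Z + 1 - k)) / (c * (1 - q) ^+ 2).

Lemma escape_drop N : escape N - escape N.+1 =
  (if sigma N.+1 == -1 then q ^ ((b N)%:Z + k) else q ^ (N%:Z - (b N)%:Z + 1 - k))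
    / (c * (1 - q)).
Proof.
have qS z : q ^ (z + 1) = q ^ z * q by rewrite expfzDr ?gt_eqF // expr1z.
have q1 : 1 - q != 0 by rewrite subr_eq0 gt_eqF.
have c0 : c != 0 by rewrite gt_eqF.
rewrite /escape bfunS; case: eqP => _.
  rewrite (_ : (b N + true)%N%:Z + k = (b N)%:Z + k + 1); last by lia.
  rewrite (_ : N.+1%:Z - _ + 1 - k = N%:Z - (b N)%:Z + 1 - k); last by lia.
  by rewrite qS; field; rewrite c0 q1.
rewrite addn0 (_ : N.+1%:Z - _ + 1 - k = N%:Z - (b N)%:Z + 1 - k + 1); last by lia.
by rewrite qS; field; rewrite c0 q1.
Qed.

Lemma escape_noninc L N : (L <= N)%N -> escape N <= escape L.
Proof.
move=> /subnKC <-; elim: (N - L)%N => [|m IHm]; first by rewrite addn0.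
apply: le_trans IHm; rewrite addnS -subr_ge0 escape_drop.
apply: divr_ge0; first by case: ifP => _; apply: exprz_ge0; apply: ltW.
by apply: mulr_ge0; rewrite ?subr_ge0 ltW.
Qed.

(** With [i = b(N) + k], the preferred value of the part [i] of [kap] is in both
    cases the part of [lam] of index [b(N+1) + k]: the upper end of the interval
    has index [i] and [b] does not move for a sign [+1], the lower end has index
    [i + 1] and [b] moves by one for a sign [-1]. *)
Lemma step_escape N (lam : GT N.+1) (v : int) :
  1 <= (b N)%:Z + k <= N%:Z -> part lam ((b N.+1)%:Z + k) = v ->
  \sum_(kap <- below lam | part kap ((b N)%:Z + k) != v)
    transition (q ^ sigma N.+1) lam kap <= escape N - escape N.+1.
Proof.
move=> /part_ord[i Ei]; rewrite bfunS escape_drop.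
under eq_bigl => kap do rewrite (part_tnth kap Ei).
have [s1|s1] := @sigma_pm1 N.+1 isT; rewrite s1 /=.
  rewrite (@part_tnth _ _ _ (lift ord_max i)) => [<-|]; last by rewrite lift_max addn0.
  rewrite expr1z (_ : N%:Z - _ + 1 - k = (N - i)%N); last by have := ltn_ord i; lia.
  exact: step_plus.
rewrite (@part_tnth _ _ _ (lift ord0 i)) => [<-|]; last by rewrite lift0; lia.
by rewrite exprN1 Ei; apply: step_minus.
Qed.

(** A union bound over the links from [N] to [L], summed by telescoping.  The
    finite list [s] stands for an arbitrary finite set of final states. *)
Lemma kernel_escape L N (lam : GT N) (s : seq (GT L)) (v : int) : (L <= N)%N ->
  1 <= (b L)%:Z + k <= L%:Z -> uniq s -> part lam ((b N)%:Z + k) = v ->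
  \sum_(nu <- s | part nu ((b L)%:Z + k) != v) kernel lam nu <= escape L - escape N.
Proof.
move=> LN kL us; have kM M : (L <= M)%N -> 1 <= (b M)%:Z + k <= M%:Z.
  move=> /subnKC <-; elim: (M - L)%N => [|m]; first by rewrite addn0.
  by rewrite addnS bfunS; case: eqP => _; lia.
have base n (kap : GT n) : n = L -> part kap ((b n)%:Z + k) = v ->
    \sum_(nu <- s | part nu ((b L)%:Z + k) != v) kernel kap nu <= escape L - escape n.
  move=> nL; subst n => kapv; rewrite subrr big1 // => nu nuv; rewrite kernel_above //.
  by case: eqP => // /val_inj/val_inj E; rewrite -E kapv eqxx in nuv.
elim: N LN lam => [|N IHN].
  by rewrite leqn0 => /eqP L0 lam; apply: base.
rewrite leq_eqVlt => /orP[/eqP LN lam|]; first by apply: base.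
rewrite ltnS => LN lam lamv; under eq_bigr do rewrite kernelS //.
rewrite exchange_big /=; have P0 := specialization_gt0 N; have P1 := specialization_neq1 N.
have T0 kap : 0 <= transition (q ^ sigma N.+1) lam kap by apply: transition_ge0.
apply: le_trans (_ : \sum_(kap <- below lam) transition (q ^ sigma N.+1) lam kap *
   (escape L - escape N + (part kap ((b N)%:Z + k) != v)%:R) <= _).
  apply: ler_sum => kap _; rewrite -mulr_sumr ler_wpM2l //.
  case: eqP => [kapv|_] /=; first by rewrite addr0 IHN.
  apply: le_trans (_ : 1 <= _).
    rewrite -big_filter; apply: kernel_mass; exact: filter_uniq.
  by rewrite lerDr subr_ge0 escape_noninc.
under eq_bigr do rewrite mulrDr.
rewrite big_split /= -mulr_suml sum_transition // mul1r.
have -> : escape L - escape N.+1 = escape L - escape N + (escape N - escape N.+1) by ring.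
rewrite lerD2l.
apply: le_trans (step_escape (kM N LN) lamv); rewrite [leRHS]big_mkcond /=.
by apply: ler_sum => kap _; case: ifP => _; rewrite ?mulr1 ?mulr0.
Qed.

End Chain.

(** * Passage to the limit *)

Section Limit.
Variables (R : realType) (q c : R) (sigma : nat -> int) (t : int -> int).
Hypotheses (q_gt0 : 0 < q) (q_lt1 : q < 1) (c_gt0 : 0 < c).
Hypothesis c_le : forall n, c <= \prod_(k < n) (1 - q ^+ k.+1).
Hypothesis sigma_pm1 : forall i, (0 < i)%N -> sigma i = 1 \/ sigma i = -1.
Hypothesis sigma_plus : infinite_set [set i : nat | (0 < i)%N /\ sigma i = 1].
Hypothesis sigma_minus : infinite_set [set i : nat | (0 < i)%N /\ sigma i = -1].
Hypothesis t_nondec : forall i j : int, i <= j -> t i <= t j.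

Local Notation b := (bfun sigma).

Lemma escape_cvg0 (k : int) : escape q c sigma k N @[N --> \oo] --> 0.
Proof.
have q0 : (fun n => q ^+ n) @ \oo --> 0 by apply: cvg_expr; rewrite gtr0_norm.
have h1 := cvg_comp _ _ (bfun_cvgy sigma_minus) q0.
have h2 := cvg_comp _ _ (bfun_co_cvgy sigma_plus) q0.
have -> : escape q c sigma k = fun N =>
    (q ^+ b N * q ^ k + q ^+ (N - b N) * q ^ (1 - k)) / (c * (1 - q) ^+ 2).
  apply/funext => N; rewrite /escape !exprnP -!expfzDr ?gt_eqF //.
  by rewrite subzn ?bfun_le // addrA.
have : (q ^+ b N * q ^ k + q ^+ (N - b N) * q ^ (1 - k)) / (c * (1 - q) ^+ 2)
    @[N --> \oo] --> (0 * q ^ k + 0 * q ^ (1 - k)) / (c * (1 - q) ^+ 2).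
  by apply: cvgM; [apply: cvgD; apply: cvgM => //|]; exact: cvg_cst.
by rewrite !mul0r addr0 mul0r.
Qed.

(** A nonzero value of [Mt] cannot be the default value of the choice operator,
    so it is a limit along every stabilizing sequence, [truncation] among
    them. *)
Lemma Mt_cvg L (nu : GT L) : Mt q sigma t nu != 0 ->
  kernel_prod q sigma (truncation sigma t N) nu @[N --> \oo] --> Mt q sigma t nu.
Proof.
rewrite /Mt; case: xgetP => [p -> hp _|_]; last by rewrite eqxx.
exact: hp (truncation_stabilizes sigma_plus sigma_minus t_nondec).
Qed.

(** The states with [Mt = 0] contribute nothing, and on the others [Mt] is a
    limit of transition probabilities. *)
Lemma Mt_escape L (s : seq (GT L)) (k : int) :
  uniq s -> 1 <= (b L)%:Z + k <= L%:Z ->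
  \sum_(nu <- s | part nu ((b L)%:Z + k) != t (1 - k)) Mt q sigma t nu
    <= escape q c sigma k L.
Proof.
move=> us kL; pose B := [pred nu : GT L | part nu ((b L)%:Z + k) != t (1 - k)].
rewrite (bigID (fun nu => Mt q sigma t nu != 0)) /= [X in _ + X]big1 ?addr0; last first.
  by move=> nu /andP[_ /negPn/eqP].
pose K N := \sum_(nu <- s | B nu && (Mt q sigma t nu != 0))
  kernel_prod q sigma (truncation sigma t N) nu.
have Kc : K N @[N --> \oo] -->
    \sum_(nu <- s | B nu && (Mt q sigma t nu != 0)) Mt q sigma t nu.
  apply: cvg_big => [|nu /andP[_ nu0]]; last exact: Mt_cvg.
  exact: add_continuous.
rewrite -(cvg_lim _ Kc) //; apply: limr_le; first by apply/cvg_ex; eexists; exact: Kc.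
apply: filterS2 (near_index sigma_plus sigma_minus k) (nbhs_infty_ge L) => N kN LN.
apply: le_trans (_ : escape q c sigma k L - escape q c sigma k N <= _); last first.
  rewrite gerBl; apply: divr_ge0.
    by apply: addr_ge0; apply: exprz_ge0; apply: ltW.
  by rewrite mulr_ge0 ?exprn_ge0 ?subr_ge0 ?(ltW c_gt0) ?(ltW q_lt1).
apply: le_trans (kernel_escape q_gt0 q_lt1 c_gt0 c_le sigma_pm1 LN kL us
  (part_truncation t_nondec kN)).
rewrite /K big_mkcondr /=; apply: ler_sum => nu _; case: ifP => // _.
exact: kernel_ge0.
Qed.

End Limit.

(** Signatures form a countable set, which is enumerated to apply countable
    subadditivity; every partial sum is a finite sum over distinct
    signatures. *)
Lemma probability_le_of_finite (d : measure_display) (R : realType)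
    (T : measurableType d) (P : probability T R) (L : nat) (X : {RV P >-> GT L})
    (m : GT L -> R) (B : pred (GT L)) (e : R) :
  (forall nu, distribution P X [set nu] = (m nu)%:E) ->
  (forall s, uniq s -> \sum_(nu <- s | B nu) m nu <= e) ->
  (P (X @^-1` [set nu | B nu]) <= e%:E)%E.
Proof.
move=> law fin.
pose F n : set T := if pickle_inv n is Some nu then
  if B nu then X @^-1` [set nu] else set0 else set0.
have FE n : P (F n) = (oapp (fun nu => if B nu then m nu else 0) 0 (pickle_inv n))%:E.
  rewrite /F; case: pickle_inv => [nu|] /=; last by rewrite measure0.
  by case: ifP => _; [exact: law | rewrite measure0].
have meas (A : set (GT L)) : measurable (X @^-1` A) by exact: measurable_funPTI.
have mF n : measurable (F n).
  by rewrite /F; case: pickle_inv => [nu|] //; case: ifP.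
apply: le_trans (@measure_sigma_subadditive _ _ _ P _ F mF (meas _) _) _.
  move=> w /= Bw; exists (pickle (X w)) => //.
  by rewrite /F pickleK_inv Bw.
apply: lime_le; first by apply: is_cvg_nneseries.
apply: nearW => n; rewrite (eq_bigr _ (fun i _ => FE i)).
rewrite sumEFin lee_fin.
apply: le_trans (fin (pmap (@pickle_inv (GT L)) (iota 0 n)) _); last first.
  by apply: (pmap_uniq (@pickle_invK _)); exact: iota_uniq.
by rewrite [leRHS]big_mkcond big_pmap /index_iota subn0.
Qed.

Theorem theorem5p5 (R : realType) (q : R) (q_gt0 : 0 < q) (q_lt1 : q < 1)
    (sigma : nat -> int)
    (sigma_pm1 : forall i, (0 < i)%N -> sigma i = 1 \/ sigma i = -1)
    (sigma_plus : infinite_set [set i : nat | (0 < i)%N /\ sigma i = 1])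
    (sigma_minus : infinite_set [set i : nat | (0 < i)%N /\ sigma i = -1])
    (t : int -> int) (t_nondec : forall i j : int, i <= j -> t i <= t j)
    (d : nat -> measure_display) (T : forall N, measurableType (d N))
    (P : forall N, probability (T N) R)
    (mu : forall N, {RV (P N) >-> GT N})
    (mu_law : forall N, (0 < N)%N -> forall nu : GT N,
      distribution (P N) (mu N) [set nu] = (Mt q sigma t nu)%:E) :
  forall k : int,
    (fun L : nat =>
       P L [set w | part (mu L w) ((bfun sigma L)%:Z + k) = t (1 - k)])
      @ \oo --> 1%E.
Proof.
move=> k; have [c c_gt0 c_le] := qpochhammer_lower_bound q_gt0 q_lt1.
pose B L := [pred nu : GT L | part nu ((bfun sigma L)%:Z + k) != t (1 - k)].
have meas L (A : set (GT L)) : measurable (mu L @^-1` A) by exact: measurable_funPTI.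
have esc0 := escape_cvg0 c q_gt0 q_lt1 sigma_plus sigma_minus k.
apply: (@squeeze_cvge _ _ _ _ (fun L => (1 - escape q c sigma k L)%:E) _ (cst 1%E)).
- apply: filterS2 (near_index sigma_plus sigma_minus k) (nbhs_infty_gt 0) => L kL L0.
  apply/andP; split; last by apply: probability_le1; apply: (meas L [set nu | part nu _ = _]).
  have -> : [set w | part (mu L w) ((bfun sigma L)%:Z + k) = t (1 - k)] =
      ~` (mu L @^-1` [set nu | B L nu]).
    apply/seteqP; split => w /=; first by move=> ->; rewrite eqxx.
    by move=> /negP/negPn/eqP.
  rewrite probability_setC // EFinB leeB //.
  apply: probability_le_of_finite (mu_law L L0) _ => s us.
  exact: (Mt_escape q_gt0 q_lt1 c_gt0 c_le sigma_pm1 sigma_plus sigma_minus t_nondec us kL).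
- apply: cvg_EFin; first by apply: nearW.
  rewrite -[X in _ --> X]subr0; apply: cvgB => //; exact: cvg_cst.
exact: cvg_cst.
Qed.
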